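(* Let $f:\mathbb{R}^n\to\mathbb{R}$ and $c:\mathbb{R}^n\to\mathbb{R}^m$ ($m\le n$) be differentiable, with $J(x)\in\mathbb{R}^{m\times n}$ the Jacobian of $c$ at $x$. Let $f_{\mathrm{low}}\in\mathbb{R}$ satisfy $f(x)\ge f_{\mathrm{low}}$ for all $x\in\mathbb{R}^n$, and let $\varepsilon_0,\varepsilon_1>0$, $\alpha>1$, $\beta_0\ge1$. Let $x_0\in\mathbb{R}^n$ satisfy $\|c(x_0)\|\le\varepsilon_0/\sqrt2$. Assume there are constants $R>\varepsilon_0$ and $\sigma_{\min}>0$ such that $$\|J(x)^\top c(x)\|\ge\sigma_{\min}\|c(x)\|\quad\text{for all } x\in\mathbb{R}^n \text{ with } \|c(x)\|\le R,$$ and assume that the sublevel set $\mathcal{L}_f(2f(x_0)-f_{\mathrm{low}})=\{x\in\mathbb{R}^n: f(x)\le 2f(x_0)-f_{\mathrm{low}}\}$ is bounded. Let $L_{f,0}\ge0$ be such that $\|\nabla f(x)\|\le L_{f,0}$ for all $x\in\mathcal{L}_f(2f(x_0)-f_{\mathrm{low}})$. Let $x_1,x_2,\dots$ be iterates generated from $x_0$ by the Quadratic Penalty Method (QPM) with penalty parameters $\beta_k=\alpha^k\beta_0$ and feasibility-aware tolerance $\tau$, and define $$T(\varepsilon_0):=\inf\{k\in\mathbb{N},\ k\ge1:\ \|c(x_k)\|\le\varepsilon_0\}.$$ Then $$T(\varepsilon_0)\le\tilde T(\varepsilon_0):=2+\log_\alpha\!\left(\max\left\{\frac{L_{f,0}+\varepsilon_1}{\sigma_{\min}},\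 \frac{4(f(x_0)-f_{\mathrm{low}})}{R}\right\}\beta_0^{-1}\varepsilon_0^{-1}\right),$$ and the point $x_{T(\varepsilon_0)}$ generated by QPM is an $(\varepsilon_0,\varepsilon_1)$-approximate KKT point, satisfying $$\|c(x_{T(\varepsilon_0)})\|\le\varepsilon_0\quad\text{and}\quad \Big\|\nabla f(x_{T(\varepsilon_0)})+\beta_{T(\varepsilon_0)-1}\sum_{i=1}^m c_i(x_{T(\varepsilon_0)})\nabla c_i(x_{T(\varepsilon_0)})\Big\|\le\varepsilon_1 .$$
   Context: $\|\cdot\|$ is the Euclidean norm. The problem is: minimize $f(x)$ subject to $c(x)=0$. A point $x$ is an $(\varepsilon_0,\varepsilon_1)$-approximate KKT point if there is $\lambda\in\mathbb{R}^m$ with $\|c(x)\|\le\varepsilon_0$ and $\|\nabla f(x)-\sum_{i=1}^m\lambda_i\nabla c_i(x)\|\le\varepsilon_1$. Quadratic penalty: $Q_\beta(x)=f(x)+\frac{\beta}{2}\|c(x)\|^2$. Feasibility-aware tolerance: for some $\tau_{\mathrm{cap}}\ge\varepsilon_1$, $\tau(x)=\max\{\varepsilon_1,\min(\tau_{\mathrm{cap}},\frac{\varepsilon_1}{\varepsilon_0}\|c(x)\|)\}$. QPM: given $\varepsilon_0,\varepsilon_1>0$, $\alpha>1$, $\beta_0\ge1$, $\tau$ and $x_0$; for $k=0,1,2,\dots$: find $x_{k+1}$ such that $Q_{\beta_k}(x_{k+1})\le\min\{Q_{\beta_k}(x_k),Q_{\beta_k}(x_0)\}$ and $\|\nabla Q_{\beta_k}(x_{k+1})\|\le\tau(x_{k+1})$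 (such points are assumed to be found at every iteration); if $\|c(x_{k+1})\|\le\varepsilon_0$, stop and return $x_{k+1}$; otherwise set $\beta_{k+1}=\alpha\beta_k$ and continue.
   Formalization: The printed bound T ≤ T̃ fails when T̃ < 1 (e.g. for large β_0), since T ≥ 1 by definition; the formal theorem proves T ≤ max{1, T̃}, which coincides with the printed bound whenever T̃ ≥ 1. *)

(* Defs.v *)
From HB Require Import structures.
From mathcomp Require Import all_boot all_order all_algebra.
From mathcomp Require Import all_classical all_reals all_analysis.

Set Implicit Arguments.
Unset Strict Implicit.
Unset Printing Implicit Defensive.

Import Order.TTheory GRing.Theory Num.Theory.
Import numFieldNormedType.Exports.

Local Open Scope classical_set_scope.
Local Open Scope ring_scope.

(* Points of R^n are row vectors 'rV[R]_n. The norm `|_| of the library on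
   matrices is the sup norm; enorm below is the Euclidean one. The two induce
   the same topology, hence the same differentiable maps and bounded sets. *)
Definition enorm (R : realType) (n : nat) (v : 'rV[R]_n) : R :=
  Num.sqrt (\sum_(i < n) v ord0 i ^+ 2).

Definition grad (R : realType) (n : nat) (f : 'rV[R]_n -> R) (x : 'rV[R]_n) :
    'rV[R]_n :=
  \row_(j < n) 'D_(delta_mx ord0 j) f x.

(* The library's 'J c x acts on row vectors on the right; the usual m x n
   matrix of partial derivatives (d c_i / d x_j)_(i, j) is its transpose. *)
Definition Jac (R : realType) (n m : nat) (c : 'rV[R]_n -> 'rV[R]_m)
    (x : 'rV[R]_n) : 'M[R]_(m, n) :=
  ('J c x)^T.

Definition component (R : realType) (n m : nat) (c : 'rV[R]_n -> 'rV[R]_m)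
    (i : 'I_m) (x : 'rV[R]_n) : R :=
  c x ord0 i.

Definition sublevel (R : realType) (n : nat) (f : 'rV[R]_n -> R) (a : R) :
    set 'rV[R]_n :=
  [set x | f x <= a].

Definition approx_KKT (R : realType) (n m : nat) (f : 'rV[R]_n -> R)
    (c : 'rV[R]_n -> 'rV[R]_m) (eps0 eps1 : R) (x : 'rV[R]_n) : Prop :=
  exists lambda : 'rV[R]_m,
    enorm (c x) <= eps0 /\
    enorm (grad f x
           - \sum_(i < m) lambda ord0 i *: grad (component c i) x) <= eps1.

Definition penalty (R : realType) (n m : nat) (f : 'rV[R]_n -> R)
    (c : 'rV[R]_n -> 'rV[R]_m) (beta : R) (x : 'rV[R]_n) : R :=
  f x + beta / 2 * enorm (c x) ^+ 2.

Definition tolerance (R : realType) (n m : nat) (c : 'rV[R]_n -> 'rV[R]_m)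
    (eps0 eps1 tau_cap : R) (x : 'rV[R]_n) : R :=
  Num.max eps1 (Num.min tau_cap (eps1 / eps0 * enorm (c x))).

Definition QPM_step (R : realType) (n m : nat) (f : 'rV[R]_n -> R)
    (c : 'rV[R]_n -> 'rV[R]_m) (tau : 'rV[R]_n -> R) (beta : R)
    (x0 x y : 'rV[R]_n) : Prop :=
  penalty f c beta y <= Num.min (penalty f c beta x) (penalty f c beta x0) /\
  enorm (grad (penalty f c beta) y) <= tau y.

(* The method stops at the first x_k, k >= 1, with enorm (c x_k) <= eps0.
   A run is encoded as an infinite sequence whose terms after the stopping
   index are unconstrained: step k is required only if it is executed. *)
Definition QPM_iterates (R : realType) (n m : nat) (f : 'rV[R]_n -> R)
    (c : 'rV[R]_n -> 'rV[R]_m) (eps0 : R) (tau : 'rV[R]_n -> R)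
    (beta : nat -> R) (x : nat -> 'rV[R]_n) : Prop :=
  forall k : nat,
    (forall j : nat, (1 <= j <= k)%N -> eps0 < enorm (c (x j))) ->
    QPM_step f c tau (beta k) (x 0%N) (x k) (x k.+1).

(* The infimum is taken in the extended reals, so that it is +oo when no
   iterate is approximately feasible. *)
Definition hitting_time (R : realType) (n m : nat) (c : 'rV[R]_n -> 'rV[R]_m)
    (eps0 : R) (x : nat -> 'rV[R]_n) : \bar R :=
  ereal_inf [set (k%:R)%:E | k in
    [set k : nat | (1 <= k)%N /\ enorm (c (x k)) <= eps0]].

Definition log_base (R : realType) (a y : R) : R := ln y / ln a.

(* Main.v *)
(** Suppose the iterate y produced with penalty parameter beta is infeasible,
    |c y| > eps0. The penalty term at x0 is at most
    (beta/4) eps0^2 < (beta/4) |c y|^2, so Q(y) <= Q(x0) gives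
    f y + (beta/4) |c y|^2 <= f x0. Hence y lies in the sublevel set, and
    |c y| <= R if beta eps0 > 4 (f x0 - f_low) / R. In that region the
    feasibility-aware tolerance is at most (eps1/eps0) |c y|, and
    grad Q = grad f + beta J^T c yields
    beta sigma |c y| <= L + (eps1/eps0) |c y|, so that
    beta eps0 <= (L + eps1) / sigma. Thus an infeasible iterate bounds beta,
    which grows geometrically. *)

Require Import Defs.
From mathcomp Require Import all_boot all_order all_algebra.
From mathcomp Require Import all_classical all_reals all_analysis.
From mathcomp Require Import ring lra.

Set Implicit Arguments.
Unset Strict Implicit.
Unset Printing Implicit Defensive.

Import Order.TTheory GRing.Theory Num.Theory.
Import numFieldNormedType.Exports.

Local Open Scope classical_set_scope.
Local Open Scope ring_scope.

Lemma enorm_ge0 (R : realType) (n : nat) (v : 'rV[R]_n) : 0 <= enorm v.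
Proof. exact: sqrtr_ge0. Qed.

Lemma sqr_enorm (R : realType) (n : nat) (v : 'rV[R]_n) :
  enorm v ^+ 2 = \sum_(i < n) v ord0 i ^+ 2.
Proof. by rewrite sqr_sqrtr // sumr_ge0 // => i _; apply: sqr_ge0. Qed.

Lemma enorm_eq0 (R : realType) (n : nat) (v : 'rV[R]_n) (i : 'I_n) :
  enorm v = 0 -> v ord0 i = 0.
Proof.
move=> v0; have := sqr_enorm v; rewrite v0 expr0n /= => /esym/eqP.
rewrite psumr_eq0 => [/allP/(_ i (mem_index_enum i))|j _]; last exact: sqr_ge0.
by rewrite sqrf_eq0 => /eqP.
Qed.

Lemma enormZ (R : realType) (n : nat) (a : R) (v : 'rV[R]_n) :
  enorm (a *: v) = `|a| * enorm v.
Proof.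
rewrite /enorm -sqrtr_sqr -sqrtrM ?sqr_ge0 // mulr_sumr.
by congr Num.sqrt; apply: eq_bigr => i _; rewrite mxE exprMn.
Qed.

Lemma enormN (R : realType) (n : nat) (v : 'rV[R]_n) : enorm (- v) = enorm v.
Proof. by rewrite -scaleN1r enormZ normrN1 mul1r. Qed.

(** Expanding the sum of squares of [enorm v * u_i - enorm u * v_i] gives twice [enorm u * enorm v]
    times the desired difference; zero norms are split off so that this factor cancels. *)
Lemma cauchy_schwarz_rV (R : realType) (n : nat) (u v : 'rV[R]_n) :
  \sum_(i < n) u ord0 i * v ord0 i <= enorm u * enorm v.
Proof.
have [u0|u0] := eqVneq (enorm u) 0.
  by rewrite u0 mul0r big1 // => i _; rewrite enorm_eq0 ?mul0r.
have [v0|v0] := eqVneq (enorm v) 0.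
  by rewrite v0 mulr0 big1 // => i _; rewrite (enorm_eq0 i v0) mulr0.
have uv_gt0 : 0 < enorm u * enorm v.
  by rewrite mulr_gt0 // lt_def enorm_ge0 ?u0 ?v0.
have : 0 <= \sum_(i < n) (enorm v * u ord0 i - enorm u * v ord0 i) ^+ 2.
  by rewrite sumr_ge0 // => i _; apply: sqr_ge0.
have -> : \sum_(i < n) (enorm v * u ord0 i - enorm u * v ord0 i) ^+ 2 =
    enorm v ^+ 2 * \sum_(i < n) u ord0 i ^+ 2
    + enorm u ^+ 2 * \sum_(i < n) v ord0 i ^+ 2
    - 2 * (enorm u * enorm v) * \sum_(i < n) u ord0 i * v ord0 i.
  rewrite !mulr_sumr -big_split /= -sumrB; apply: eq_bigr => i _; ring.
rewrite -!sqr_enorm => h; rewrite -subr_ge0 -(pmulr_rge0 _ uv_gt0); lra.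
Qed.

Lemma ler_enormD (R : realType) (n : nat) (u v : 'rV[R]_n) :
  enorm (u + v) <= enorm u + enorm v.
Proof.
rewrite -ler_sqr ?nnegrE ?addr_ge0 ?enorm_ge0 // sqrrD !sqr_enorm.
have -> : \sum_(i < n) (u + v) ord0 i ^+ 2 = \sum_(i < n) u ord0 i ^+ 2
    + (\sum_(i < n) u ord0 i * v ord0 i) *+ 2 + \sum_(i < n) v ord0 i ^+ 2.
  rewrite -sumrMnl -!big_split /=.
  by apply: eq_bigr => i _; rewrite mxE sqrrD.
by rewrite lerD2r lerD2l lerMn2r /= cauchy_schwarz_rV.
Qed.

Section gradients.
Variables (R : realType) (n m : nat).
Implicit Types (f : 'rV[R]_n -> R) (c : 'rV[R]_n -> 'rV[R]_m) (x : 'rV[R]_n).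

Lemma derivable_component c i x v :
  differentiable c x -> derivable (component c i) x v.
Proof.
move=> dc; have /derivable_mxP : derivable c x v by exact: diff_derivable.
exact.
Qed.

Lemma derive_component c i x v :
  differentiable c x -> 'D_v (component c i) x = 'D_v c x ord0 i.
Proof. by move=> dc; rewrite derive_mx ?mxE //; exact: diff_derivable. Qed.

(** Links the matrix form of the regularity assumption to the sum of gradients in the KKT
    condition. *)
Lemma mulmx_Jac c (u : 'rV[R]_m) x : differentiable c x ->
  u *m Jac c x = \sum_(i < m) u ord0 i *: grad (component c i) x.
Proof.
move=> dc; apply/rowP => j; rewrite !mxE summxE; apply: eq_bigr => i _.
rewrite !mxE derive_component // deriveEjacobian // -rowE.
by rewrite !mxE.
Qed.

Lemma grad_penalty f c beta x : differentiable f x -> differentiable c x ->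
  grad (penalty f c beta) x = grad f x + beta *: (c x *m Jac c x).
Proof.
move=> df dc; rewrite mulmx_Jac //; apply/rowP => j.
rewrite !mxE summxE.
set v := delta_mx ord0 j.
(* As an identity in the ring of functions, so that the derivative rules for sums and powers
   apply. *)
have -> : penalty f c beta =
    f + (beta / 2) \*: \sum_(i < m) component c i ^+ 2.
  apply/funext => y; rewrite /penalty sqr_enorm /GRing.add /=.
  by rewrite fct_sumE.
have dcX i : derivable (component c i ^+ 2) x v.
  by apply: derivableX; exact: derivable_component.
have ds : derivable (\sum_(i < m) component c i ^+ 2) x v.
  exact: derivable_sum.
rewrite deriveD; [|exact: diff_derivable|exact: derivableZ].
rewrite deriveZ // derive_sum //; congr (_ + _).
rewrite scaler_sumr mulr_sumr; apply: eq_bigr => i _.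
rewrite deriveX; last exact: derivable_component.
rewrite !mxE expr1 /GRing.scale /= -/v /component; by field.
Qed.

End gradients.

Lemma infeasible_step_bound (R : realType) (n m : nat)
  (f : 'rV[R]_n -> R) (c : 'rV[R]_n -> 'rV[R]_m)
  (hf : forall x, differentiable f x) (hc : forall x, differentiable c x)
  (f_low : R) (hlow : forall x, f_low <= f x)
  (eps0 eps1 : R) (heps0 : 0 < eps0) (heps1 : 0 < eps1)
  (Rad sigma : R) (hRad : eps0 < Rad) (hsigma : 0 < sigma)
  (hJ : forall x, enorm (c x) <= Rad ->
     sigma * enorm (c x) <= enorm (c x *m Jac c x))
  (tau_cap beta L : R) (hbeta : 0 < beta) (x0 x y : 'rV[R]_n)
  (hx0 : enorm (c x0) <= eps0 / Num.sqrt 2)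
  (hL0 : 0 <= L)
  (hL : forall y, sublevel f (2 * f x0 - f_low) y -> enorm (grad f y) <= L)
  (hy : QPM_step f c (tolerance c eps0 eps1 tau_cap) beta x0 x y)
  (infeasible : eps0 < enorm (c y)) :
  beta * eps0 <= Num.max ((L + eps1) / sigma) (4 * (f x0 - f_low) / Rad).
Proof.
have Rad_gt0 : 0 < Rad by exact: lt_trans hRad.
(* By contradiction: [hM2] will place [y] where [hJ] applies, and [hM1] will clash with the gradient
   bound. *)
rewrite leNgt gt_max ltr_pdivrMr // ltr_pdivrMr //.
apply/negP => /andP[hM1 hM2].
case: hy; rewrite le_min => /andP[_ Qy] gQ.
have c0_le : enorm (c x0) ^+ 2 <= eps0 ^+ 2 / 2.
  rewrite -[2 in leRHS](@sqr_sqrtr R) // -expr_div_n.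
  by rewrite ler_sqr ?nnegrE ?enorm_ge0 // divr_ge0 ?sqrtr_ge0 ?ltW.
move: Qy gQ infeasible (hJ y) (hL y); rewrite /penalty.
set s := enorm (c y) => Qy gQ s_gt hJy hLy.
have s_gt0 : 0 < s by exact: lt_trans s_gt.
have sq_lt : eps0 ^+ 2 < s ^+ 2 by rewrite ltr_sqr ?nnegrE ?ltW.
have Q0 : beta * enorm (c x0) ^+ 2 <= beta * (eps0 ^+ 2 / 2).
  by rewrite ler_pM2l.
have Q1 : beta * eps0 ^+ 2 < beta * s ^+ 2 by rewrite ltr_pM2l.
have fy : f y + beta * s ^+ 2 / 4 <= f x0 by lra.
have y_sub : f y <= 2 * f x0 - f_low.
  have : 0 <= beta * s ^+ 2 by rewrite mulr_ge0 ?sqr_ge0 ?ltW.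
  have := hlow x0; lra.
(* From [fy], [f_low <= f y] and [hM2], [s ^+ 2 < eps0 * Rad]; since [eps0 < s], one factor [eps0]
   cancels. *)
have s_Rad : s <= Rad.
  have h1 : beta * s ^+ 2 < beta * (eps0 * Rad).
    by have := hlow y; rewrite mulrA; lra.
  rewrite ltr_pM2l // in h1.
  apply/ltW; rewrite -(ltr_pM2l heps0); apply: le_lt_trans h1.
  by rewrite expr2 ler_pM2r // ltW.
(* Infeasibility gives [eps1 <= eps1 / eps0 * s], so both arguments of the max are bounded. *)
have {}gQ : enorm (grad (penalty f c beta) y) <= eps1 / eps0 * s.
  apply: le_trans gQ _; rewrite ge_max ge_min lexx orbT andbT.
  by rewrite mulrAC ler_pdivlMr // ler_pM2l // ltW.
have Jc_le : beta * enorm (c y *m Jac c y) <= L + eps1 / eps0 * s.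
  rewrite -{1}(gtr0_norm hbeta) -enormZ.
  have -> : beta *: (c y *m Jac c y) =
      - grad f y + grad (penalty f c beta) y.
    by rewrite grad_penalty // addKr.
  by rewrite (le_trans (ler_enormD _ _)) // enormN lerD // hLy.
have sJ := hJy s_Rad.
have : beta * (sigma * s) <= L + eps1 / eps0 * s.
  by apply: le_trans Jc_le; rewrite ler_pM2l.
(* After scaling by [eps0], [L * eps0 + eps1 * s <= (L + eps1) * s], and [hM1] bounds this
   strictly. *)
apply/negP; rewrite -ltNge -(ltr_pM2l heps0).
apply: (@le_lt_trans _ _ ((L + eps1) * s)).
  have -> : eps0 * (L + eps1 / eps0 * s) = L * eps0 + eps1 * s.
    by field; rewrite gt_eqF.
  by rewrite mulrDl lerD2r ler_wpM2l // ltW.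
have -> : eps0 * (beta * (sigma * s)) = beta * eps0 * sigma * s by ring.
by rewrite ltr_pM2r.
Qed.

Lemma pow_le_log_base (R : realType) (a b : R) (k : nat) :
  1 < a -> a ^+ k <= b -> k%:R <= log_base a b.
Proof.
move=> a1 ab; have a0 : 0 < a by exact: lt_trans a1.
rewrite /log_base ler_pdivlMr ?ln_gt0 // mulr_natl -lnXn //.
have ak0 : 0 < a ^+ k by exact: exprn_gt0.
by rewrite ler_ln ?posrE // (lt_le_trans ak0).
Qed.

Lemma hitting_time_first (R : realType) (n m : nat)
  (c : 'rV[R]_n -> 'rV[R]_m) (eps0 : R) (x : nat -> 'rV[R]_n) (T : nat) :
  (1 <= T)%N -> enorm (c (x T)) <= eps0 ->
  (forall k, (1 <= k)%N -> enorm (c (x k)) <= eps0 -> (T <= k)%N) ->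
  hitting_time c eps0 x = (T%:R)%:E.
Proof.
move=> T1 cT Tmin; apply/eqP; rewrite eq_le; apply/andP; split.
  by apply: ereal_inf_lbound; exists T.
by apply: le_ereal_inf_tmp => _ [k [k1 ck] <-]; rewrite lee_fin ler_nat Tmin.
Qed.

Theorem theorem4p4 (R : realType) (n m : nat) (hmn : (m <= n)%N)
  (f : 'rV[R]_n -> R) (c : 'rV[R]_n -> 'rV[R]_m)
  (hf : forall x, differentiable f x)
  (hc : forall x, differentiable c x)
  (f_low : R) (hlow : forall x, f_low <= f x)
  (eps0 eps1 alpha beta0 : R)
  (heps0 : 0 < eps0) (heps1 : 0 < eps1) (halpha : 1 < alpha)
  (hbeta0 : 1 <= beta0)
  (Rad sigma_min : R) (hRad : eps0 < Rad) (hsigma : 0 < sigma_min)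
  (hJ : forall x, enorm (c x) <= Rad ->
     (* the row vector c x *m Jac c x is the transpose of J(x)^T c(x) *)
     sigma_min * enorm (c x) <= enorm (c x *m Jac c x))
  (tau_cap : R) (htau : eps1 <= tau_cap)
  (x : nat -> 'rV[R]_n)
  (hx0 : enorm (c (x 0%N)) <= eps0 / Num.sqrt 2)
  (hbounded : bounded_set (sublevel f (2 * f (x 0%N) - f_low)))
  (L_f0 : R) (hL0 : 0 <= L_f0)
  (hL : forall y, sublevel f (2 * f (x 0%N) - f_low) y ->
     enorm (grad f y) <= L_f0)
  (hx : QPM_iterates f c eps0 (tolerance c eps0 eps1 tau_cap)
          (fun k => alpha ^+ k * beta0) x) :
  exists T : nat,
    [/\ hitting_time c eps0 x = (T%:R)%:E,
        (* T >= 1 by definition, while the second term may be < 1 (large beta0) *)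
        (hitting_time c eps0 x <=
          (Num.max 1
            (2 + log_base alpha
               (Num.max ((L_f0 + eps1) / sigma_min)
                        (4 * (f (x 0%N) - f_low) / Rad)
                * beta0^-1 * eps0^-1)))%:E)%E,
        approx_KKT f c eps0 eps1 (x T),
        enorm (c (x T)) <= eps0 &
        enorm (grad f (x T)
               + (alpha ^+ T.-1 * beta0) *:
                 \sum_(i < m) c (x T) ord0 i *: grad (component c i) (x T))
          <= eps1].
Proof.
set l := log_base alpha _.
(* The index shifts by one: [x k.+1] is computed with penalty [alpha ^+ k * beta0], so its
   infeasibility bounds [alpha ^+ k]. *)
have infeasible_le k : (forall j, (1 <= j <= k.+1)%N -> eps0 < enorm (c (x j))) ->
    k%:R <= l.
  move=> infeas; apply: pow_le_log_base => //.
  have b0 : 0 < beta0 by exact: lt_le_trans hbeta0.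
  have step : QPM_step f c (tolerance c eps0 eps1 tau_cap)
      (alpha ^+ k * beta0) (x 0%N) (x k) (x k.+1).
    by apply: hx => j /andP[j1 jk]; apply: infeas; rewrite j1 leqW.
  rewrite ler_pdivlMr // ler_pdivlMr // mulrAC.
  apply: (infeasible_step_bound hf hc hlow heps0 heps1 hRad hsigma hJ
    _ hx0 hL0 hL step).
    by rewrite mulr_gt0 // exprn_gt0 // (lt_trans _ halpha).
  by apply: infeas; rewrite /= leqnn.
have [T /andP[T1 cT] Tmin] : exists2 T, (1 <= T)%N && (enorm (c (x T)) <= eps0)
    & forall k, (1 <= k)%N && (enorm (c (x k)) <= eps0) -> (T <= k)%N.
  suff ex : exists k, (1 <= k)%N && (enorm (c (x k)) <= eps0).
    by case: (ex_minnP ex) => T; exists T.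
  (* A run that is never feasible would make [l] an upper bound of all naturals. *)
  apply: contrapT => /forallNP never.
  have : forall k, k%:R <= l.
    move=> k; apply: infeasible_le => j /andP[j1 _].
    by move/negP: (never j); rewrite j1 -ltNge.
  move=> /(_ (Num.bound `|l|)) le_l.
  have := archi_boundP (normr_ge0 l).
  by rewrite ltNge (le_trans le_l) ?ler_norm.
have before j : (1 <= j <= T.-1)%N -> eps0 < enorm (c (x j)).
  move=> /andP[j1 jT]; rewrite ltNge; apply/negP => cj.
  by have := Tmin j; rewrite j1 cj => /(_ isT); rewrite -(prednK T1) ltnNge jT.
have T_hit : hitting_time c eps0 x = T%:R%:E.
  by apply: hitting_time_first => // k k1 ck; rewrite Tmin ?k1.
have KKT : enorm (grad f (x T) + (alpha ^+ T.-1 * beta0) *: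
    \sum_(i < m) c (x T) ord0 i *: grad (component c i) (x T)) <= eps1.
  (* Step [T.-1] is executed by minimality of [T], and at the feasible point [x T] the tolerance is
     at most [eps1]. *)
  have [_] := hx _ before; rewrite prednK // -mulmx_Jac // -grad_penalty //.
  move/le_trans; apply; rewrite ge_max lexx ge_min; apply/orP; right.
  by rewrite mulrAC ler_pdivrMr // ler_pM2l.
exists T; split => //.
(* [T = 1] falls under the max with 1. For [T = K + 2] the last infeasible iterate is [x K.+1], so
   [K <= l]: hence the constant 2. *)
- rewrite T_hit lee_fin le_max; case: T T1 before {cT Tmin T_hit KKT} => // -[|K] _ before.
    by rewrite lexx.
  by rewrite -addn2 natrD addrC lerD2l infeasible_le ?orbT.
(* The multipliers are minus the penalty parameter times [c], as the KKT condition subtracts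
   them. *)
- exists (\row_i - (alpha ^+ T.-1 * beta0 * c (x T) ord0 i)); split => //.
  rewrite (le_trans _ KKT) // -sumrN scaler_sumr.
  rewrite le_eqVlt; apply/orP; left; apply/eqP; congr (enorm (_ + _)).
  by apply: eq_bigr => i _; rewrite mxE scaleNr opprK scalerA.
Qed.
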